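(* Let $\underline{A},\overline{A}\in\mathbb{R}^{n\times n}$ with $\underline{A}\le\overline{A}$ (entrywise), let $\mathbf{A}=\{A\in\mathbb{R}^{n\times n} : \underline{A}\le A\le\overline{A}\}$, and let $A^c=\frac12(\underline{A}+\overline{A})$ and $A^\Delta=\frac12(\overline{A}-\underline{A})$. Assume that $A^c$ and $A^\Delta$ are symmetric and that $A^c$ is an $M$-matrix. Then: (1) $\mathbf{A}$ is strongly copositive if and only if $\underline{A}$ is an $M_0$-matrix; (2) $\mathbf{A}$ is strongly strictly copositive if and only if $\underline{A}$ is an $M$-matrix.
   Context: All inequalities between vectors or matrices are entrywise. A matrix property holds strongly for an interval matrix $\mathbf{A}$ if it holds for every $A\in\mathbf{A}$. A matrix $A\in\mathbb{R}^{n\times n}$ is copositive if $x^TAx\ge 0$ for each $x\ge 0$; it is strictly copositive if $x^TAx>0$ for each $x\ge 0$, $x\ne 0$. A matrix $A\in\mathbb{R}^{n\times n}$ is an $M$-matrix if $A=sI_n-N$ for some $N\ge 0$ and $s\in\mathbb{R}$ with $s>\rho(N)$; it is an $M_0$-matrix if $A=sI_n-N$ for some $N\ge0$ and $s\in\mathbb{R}$ with $s\ge\rho(N)$. Here $\rho$ is the spectral radius and $I_n$ the identity matrix. *)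

(* Defs.v *)
From HB Require Import structures.
From mathcomp Require Import all_boot all_order all_algebra.
From mathcomp Require Import complex.
From mathcomp Require Import classical_sets reals.

Set Implicit Arguments.
Unset Strict Implicit.
Unset Printing Implicit Defensive.

Import Order.TTheory GRing.Theory Num.Theory.

Local Open Scope classical_set_scope.
Local Open Scope ring_scope.

Definition lemx (R : realType) (m n : nat) (A B : 'M[R]_(m, n)) : Prop :=
  forall i j, A i j <= B i j.

Definition interval_mx (R : realType) (n : nat) (Al Au : 'M[R]_n) :
    set 'M[R]_n :=
  [set A | lemx Al A /\ lemx A Au].

Definition mx_center (R : realType) (n : nat) (Al Au : 'M[R]_n) : 'M[R]_n :=
  2^-1 *: (Al + Au).

Definition mx_radius (R : realType) (n : nat) (Al Au : 'M[R]_n) : 'M[R]_n :=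
  2^-1 *: (Au - Al).

Definition strongly (R : realType) (n : nat)
    (P : 'M[R]_n -> Prop) (AA : set 'M[R]_n) : Prop :=
  forall A, AA A -> P A.

Definition copositive (R : realType) (n : nat) (A : 'M[R]_n) : Prop :=
  forall x : 'cV[R]_n, lemx 0 x -> 0 <= (x^T *m A *m x) 0 0.

Definition strictly_copositive (R : realType) (n : nat) (A : 'M[R]_n) : Prop :=
  forall x : 'cV[R]_n, lemx 0 x -> x != 0 -> 0 < (x^T *m A *m x) 0 0.

(* The largest modulus of a complex eigenvalue.  The set is finite, and
   nonempty as soon as 0 < n; for n = 0 the value is sup set0 = 0. *)
Definition spectral_radius (R : realType) (n : nat) (A : 'M[R]_n) : R :=
  sup [set ComplexField.Normc.normc z |
        z in [set z : R[i] | eigenvalue (map_mx (real_complex R) A) z]].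

Definition M_matrix (R : realType) (n : nat) (A : 'M[R]_n) : Prop :=
  exists (N : 'M[R]_n) (s : R),
    [/\ lemx 0 N, A = s%:M - N & spectral_radius N < s].

Definition M0_matrix (R : realType) (n : nat) (A : 'M[R]_n) : Prop :=
  exists (N : 'M[R]_n) (s : R),
    [/\ lemx 0 N, A = s%:M - N & spectral_radius N <= s].

(* Main.v *)
(* Every matrix of the interval dominates Al entrywise, so both (strict)
   copositivity claims concern Al alone, which is symmetric with nonpositive
   off-diagonal entries.  Write Al = s I - N with N >= 0.  If z is an eigenvalue
   of N with left eigenvector v, then |z| |v| <= |v| N, so copositivity tested
   at the vector |v| gives |z| <= s.  Conversely, by the spectral theorem the
   Rayleigh quotients of the symmetric matrix N are at most rho(N). *)
Require Import Defs.
From mathcomp Require Import all_boot all_order all_algebra.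
From mathcomp Require Import complex.
From mathcomp Require Import classical_sets reals.

Set Implicit Arguments.
Unset Strict Implicit.
Unset Printing Implicit Defensive.

Import Order.TTheory GRing.Theory Num.Theory.

Local Open Scope ring_scope.
Local Open Scope complex_scope.
Local Open Scope sesquilinear_scope.

Notation normc := ComplexField.Normc.normc.

(** * Moduli, symmetric matrices and quadratic forms *)

Lemma normc_ge0 (R : rcfType) (z : R[i]) : 0 <= normc z.
Proof. by case: z => a b; exact: sqrtr_ge0. Qed.

Lemma normcR (R : rcfType) (z : R[i]) : real_complex R (normc z) = `|z|.
Proof. by []. Qed.

Lemma symmetricmxP {F : fieldType} {n : nat} {A : 'M[F]_n} :
  reflect (A^T = A) (A \is symmetricmx).
Proof.
have E : (-1) ^+ false *: map_mx idfun A^T = A^T.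
  by rewrite expr0 scale1r map_mx_id.
by apply: (iffP (is_hermitianmxP _ _ _)); rewrite E.
Qed.

Lemma qformE (R : comPzRingType) (n : nat) (A : 'M[R]_n) (x : 'cV[R]_n) :
  (x^T *m A *m x) 0 0 = \sum_i \sum_j x i 0 * A i j * x j 0.
Proof.
rewrite mxE exchange_big; apply: eq_bigr => j _.
by rewrite mxE mulr_suml; apply: eq_bigr => i _; rewrite mxE.
Qed.

Lemma dot_colE (R : comPzRingType) (n : nat) (x : 'cV[R]_n) :
  (x^T *m x) 0 0 = \sum_i x i 0 ^+ 2.
Proof. by rewrite mxE; apply: eq_bigr => i _; rewrite mxE. Qed.

Lemma qformB_scalar (R : comPzRingType) (n : nat) (N : 'M[R]_n) s
    (x : 'cV[R]_n) :
  (x^T *m (s%:M - N) *m x) 0 0 = s * (x^T *m x) 0 0 - (x^T *m N *m x) 0 0.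
Proof. by rewrite mulmxBr mulmxBl mul_mx_scalar -scalemxAl !mxE. Qed.

Lemma dot_col_gt0 (R : realDomainType) (n : nat) (x : 'cV[R]_n) :
  x != 0 -> 0 < (x^T *m x) 0 0.
Proof.
move=> x0; rewrite dot_colE lt0r sumr_ge0 ?andbT; last by move=> i _; exact: sqr_ge0.
apply: contraNN x0; rewrite psumr_eq0 => [/allP x0|i _]; last exact: sqr_ge0.
apply/eqP/colP => i; rewrite mxE; apply/eqP.
by rewrite -sqrf_eq0; apply: x0; rewrite mem_index_enum.
Qed.

(** * Unitary diagonalization and eigenvalues *)

Lemma spectral_diag_eigenvalue (C : numClosedFieldType) (n : nat) (A : 'M[C]_n) i :
  A \is normalmx -> eigenvalue A (spectral_diag A 0 i).
Proof.
move=> /orthomx_spectralP; have Pu := spectral_unit A.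
set P := spectralmx A in Pu *; set d := spectral_diag A => defA.
(* [eigenvalue] is about left eigenvectors, so the rows of [P] serve: [A = P^-1 D P] gives
   [P A = D P]. *)
apply/eigenvalueP; exists (row i P).
  rewrite -row_mul [in P *m A]defA !mulmxA mulmxV // mul1mx.
  by apply/rowP => j; rewrite mul_diag_mx !mxE.
(* If this row vanished, multiplying by [P^-1] would make row [i] of the identity vanish. *)
apply/eqP => /(congr1 (mulmx^~ (invmx P))); rewrite mul0mx -row_mul mulmxV //.
by move=> /rowP/(_ i)/eqP; rewrite !mxE eqxx oner_eq0.
Qed.

(** In the unitary coordinates [y = u P^*] the form is the sum of the [d_i |y_i|^2], where each
    eigenvalue [d_i] is real and hence at most [|d_i| <= r]. *)
Lemma hermitian_form_le (C : numClosedFieldType) (n : nat) (A : 'M[C]_n) (r : C)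
    (u : 'rV[C]_n) :
  A \is hermsymmx -> (forall a, eigenvalue A a -> `|a| <= r) ->
  (u *m A *m u^t*) 0 0 <= r * (u *m u^t*) 0 0.
Proof.
move=> Ah ler; have An := hermitian_normalmx Ah.
have Pu := spectral_unitarymx A.
have /mxOverP dreal := hermitian_spectral_diag_real Ah.
have dle i := ler _ (spectral_diag_eigenvalue i An).
have /orthomx_spectralP := An; rewrite invmx_unitary //.
set P := spectralmx A in Pu *; set d := spectral_diag A in dreal dle * => ->.
pose y := u *m P^t*.
have yE : y^t* = P *m u^t* by rewrite trmx_mul map_mxM trmxCK.
have -> : u *m u^t* = y *m y^t* by rewrite yE !mulmxA mulmxKtV.
have -> : u *m (P^t* *m diag_mx d *m P) *m u^t* = y *m diag_mx d *m y^t*.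
  by rewrite yE !mulmxA.
rewrite mul_mx_diag !mxE mulr_sumr; apply: ler_sum => i _; rewrite !mxE.
rewrite mulrAC mulrC -normCK ler_wpM2r ?exprn_ge0 //.
by rewrite (le_trans _ (dle i)) // real_ler_norm.
Qed.

(** Finiteness of the spectrum: it makes the supremum in [spectral_radius] a genuine upper bound and
    lets strict bounds pass to it. *)
Lemma eigenvalue_seq (C : closedFieldType) (n : nat) (A : 'M[C]_n) :
  exists s : seq C, forall z, eigenvalue A z = (z \in s).
Proof.
have [s defp] := closed_field_poly_normal (char_poly A).
exists s => z; rewrite eigenvalue_root_char defp.
by rewrite (monicP (char_poly_monic A)) scale1r root_prod_XsubC.
Qed.

(** * The spectral radius of a real matrix *)

Section SpectralRadius.
Variables (R : realType) (n : nat) (A : 'M[R]_n).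
Local Notation AC := (map_mx (real_complex R) A).

Lemma spectral_radius_ub z :
  eigenvalue AC z -> normc z <= spectral_radius A.
Proof.
move=> ez; apply: ub_le_sup; last by exists z.
have [s Es] := eigenvalue_seq AC.
exists (\big[Num.max/0]_(w <- s) normc w) => _ [w /= ew <-].
by apply: le_bigmax_seq; rewrite // -Es.
Qed.

Lemma spectral_radius_le r :
  0 <= r -> (forall z, eigenvalue AC z -> normc z <= r) ->
  spectral_radius A <= r.
Proof.
move=> r0 ler; rewrite /spectral_radius; set E := (X in sup X).
(* An empty spectrum has supremum 0, which is where [0 <= r] enters. *)
have [->|E0] := eqVneq E set0; first by rewrite sup0.
by apply: ge_sup => [|_ [z /= ez <-]]; [exact/set0P | exact: ler].
Qed.

Lemma spectral_radius_lt r :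
  0 < r -> (forall z, eigenvalue AC z -> normc z < r) ->
  spectral_radius A < r.
Proof.
move=> r0 ltr; have [s Es] := eigenvalue_seq AC.
(* A bare supremum would only give [<=]; a maximum over a finite list, with floor [0 < r], stays
   strictly below [r]. *)
apply: (@le_lt_trans _ _ (\big[Num.max/0]_(w <- s) normc w)).
  apply: spectral_radius_le => [|z]; first exact: bigmax_ge_id.
  by rewrite Es => zs; apply: le_bigmax_seq.
rewrite big_seq; apply: bigmax_lt => // z; rewrite -Es; exact: ltr.
Qed.

(** Over the complex numbers [A] is Hermitian and [x] is its own conjugate, so the real form is an
    instance of [hermitian_form_le]. *)
Lemma qform_le_spectral_radius (x : 'cV[R]_n) :
  A \is symmetricmx ->
  (x^T *m A *m x) 0 0 <= spectral_radius A * (x^T *m x) 0 0.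
Proof.
move=> As; pose u := map_mx (real_complex R) x^T.
have real_cC (a : R) : Num.conj (real_complex R a) = real_complex R a.
  by apply/CrealP; rewrite complex_real.
have uE : u^t* = map_mx (real_complex R) x.
  by apply/matrixP => i j; rewrite !mxE real_cC.
have ACh : AC \is hermsymmx.
  apply: realsym_hermsym; last by apply/mxOverP => i j; rewrite mxE complex_real.
  by apply/symmetricmxP; rewrite map_trmx (symmetricmxP As).
have := @hermitian_form_le _ _ _ (real_complex R (spectral_radius A)) u ACh.
rewrite uE /u -!map_mxM !mxE -rmorphM lecR; apply => z ez.
by rewrite lecR spectral_radius_ub.
Qed.

(* The vector of moduli of a complex eigenvector is a subeigenvector. *)
Lemma eigenvalue_nneg_qform z :
  lemx 0 A -> eigenvalue AC z ->
  exists2 y : 'cV[R]_n, lemx 0 y /\ y != 0 &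
    normc z * (y^T *m y) 0 0 <= (y^T *m A *m y) 0 0.
Proof.
move=> A0 /eigenvalueP[v vz v0]; exists (\col_i normc (v 0 i)).
  split=> [i j|]; first by rewrite !mxE normc_ge0.
  apply: contraNneq v0 => /colP y0; apply/eqP/rowP => i; rewrite mxE.
  by have := y0 i; rewrite !mxE => /ComplexField.Normc.eq0_normc.
rewrite dot_colE qformE exchange_big mulr_sumr; apply: ler_sum => j _.
rewrite !mxE -mulr_suml expr2 mulrA ler_wpM2r ?normc_ge0 //.
have /rowP/(_ j) := vz; rewrite !mxE -lecR rmorphM /= !normcR => vzj.
rewrite -normrM -vzj (le_trans (ler_norm_sum _ _ _)) //.
rewrite rmorph_sum; apply: ler_sum => i _ /=.
rewrite !mxE normrM rmorphM; apply: (ler_wpM2l (normr_ge0 _)).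
by rewrite ger0_norm // lecR; have := A0 i j; rewrite mxE.
Qed.

End SpectralRadius.

(** * Copositivity of symmetric matrices with nonpositive off-diagonal entries *)

Section SymmetricZMatrix.
Variables (R : realType) (n : nat) (A : 'M[R]_n).
Hypothesis A_sym : A \is symmetricmx.
Hypothesis A_off : forall i j, i != j -> A i j <= 0.

(** The [N] supplied by [M_matrix] or [M0_matrix] is arbitrary; the Rayleigh bound needs it
    symmetric. *)
Lemma shift_symmetric N s : A = s%:M - N -> N \is symmetricmx.
Proof.
move=> defA; have -> : N = s%:M - A by rewrite defA opprB addrC subrK.
by apply/symmetricmxP; rewrite linearB /= tr_scalar_mx (symmetricmxP _).
Qed.

Lemma Zmatrix_split :
  exists N s, [/\ lemx 0 N, A = s%:M - N & 0 < s].
Proof.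
(* Dominating the diagonal makes [s I - A] nonnegative; the floor 1 keeps [s] positive, also for
   [n = 0], as [spectral_radius_lt] requires. *)
pose s := \big[Num.max/1]_i A i i.
exists (s%:M - A), s; split; last 1 first.
- by apply: lt_le_trans ltr01 _; exact: bigmax_ge_id.
- move=> i j; rewrite !mxE; have [<-|ij] := eqVneq i j.
    by rewrite mulr1n subr_ge0; exact: (le_bigmax _ (fun i => A i i)).
  by rewrite mulr0n sub0r oppr_ge0 A_off.
- by rewrite opprB addrC subrK.
Qed.

Lemma copositive_M0_matrix : copositive A <-> M0_matrix A.
Proof.
split=> [Acop|[N [s [N0 defA rhoN]]] x _].
  have [N [s [N0 defA s0]]] := Zmatrix_split; exists N, s; split=> //.
  apply: spectral_radius_le => [|z /(eigenvalue_nneg_qform N0)]; first exact: ltW.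
  (* Now [|z| y^T y <= y^T N y <= s y^T y], and the positive factor [y^T y] cancels. *)
  move=> [y [y0 yN0] lez]; have := Acop y y0; rewrite defA qformB_scalar subr_ge0.
  by move=> /(le_trans lez); rewrite ler_pM2r // dot_col_gt0.
rewrite defA qformB_scalar subr_ge0.
apply: le_trans (qform_le_spectral_radius x (shift_symmetric defA)) _.
(* Cancelling [x^T x] requires it to be positive, so [x = 0] is treated apart. *)
have [->|x0] := eqVneq x 0; first by rewrite mulmx0 mxE !mulr0.
by rewrite ler_pM2r // dot_col_gt0.
Qed.

Lemma strictly_copositive_M_matrix : strictly_copositive A <-> M_matrix A.
Proof.
split=> [Acop|[N [s [N0 defA rhoN]]] x _ x0].
  have [N [s [N0 defA s0]]] := Zmatrix_split; exists N, s; split=> //.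
  apply: spectral_radius_lt => // z /(eigenvalue_nneg_qform N0).
  move=> [y [y0 yN0] lez]; have := Acop y y0 yN0; rewrite defA qformB_scalar subr_gt0.
  by move=> /(le_lt_trans lez); rewrite ltr_pM2r // dot_col_gt0.
rewrite defA qformB_scalar subr_gt0.
apply: le_lt_trans (qform_le_spectral_radius x (shift_symmetric defA)) _.
by rewrite ltr_pM2r // dot_col_gt0.
Qed.

End SymmetricZMatrix.

(** * Reduction from the interval to its lower bound *)

Lemma qform_monotone (R : realType) (n : nat) (A B : 'M[R]_n) (x : 'cV[R]_n) :
  lemx A B -> lemx 0 x -> (x^T *m A *m x) 0 0 <= (x^T *m B *m x) 0 0.
Proof.
move=> AB x0; rewrite !qformE; have x_ge0 i : 0 <= x i 0.
  by have := x0 i 0; rewrite mxE.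
by apply: ler_sum => i _; apply: ler_sum => j _; rewrite ler_wpM2r ?ler_wpM2l.
Qed.

Section Interval.
Variables (R : realType) (n : nat) (Al Au : 'M[R]_n).
Hypothesis hle : lemx Al Au.

Lemma interval_mx_lower : interval_mx Al Au Al.
Proof. by split. Qed.

Lemma strongly_copositive_lower :
  strongly (@copositive R n) (interval_mx Al Au) <-> copositive Al.
Proof.
split=> [|Alc A [AlA _] x x0]; first by apply; exact: interval_mx_lower.
exact: le_trans (Alc x x0) (qform_monotone AlA x0).
Qed.

Lemma strongly_strictly_copositive_lower :
  strongly (@strictly_copositive R n) (interval_mx Al Au) <->
  strictly_copositive Al.
Proof.
split=> [|Alc A [AlA _] x x0 xN0]; first by apply; exact: interval_mx_lower.
exact: lt_le_trans (Alc x x0 xN0) (qform_monotone AlA x0).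
Qed.

Lemma lower_symmetric :
  mx_center Al Au \is symmetricmx -> mx_radius Al Au \is symmetricmx ->
  Al \is symmetricmx.
Proof.
move=> /symmetricmxP cs /symmetricmxP rs.
suff -> : Al = mx_center Al Au - mx_radius Al Au.
  by apply/symmetricmxP; rewrite linearB /= cs rs.
rewrite /mx_center /mx_radius -scalerBr opprB addrACA subrr addr0.
by rewrite -mulr2n -scaler_nat scalerA mulVf ?scale1r // pnatr_eq0.
Qed.

Lemma lower_off_diagonal i j :
  M_matrix (mx_center Al Au) -> i != j -> Al i j <= 0.
Proof.
move=> [N [s [N0 /matrixP/(_ i j) + _]]] ij.
rewrite !mxE (negPf ij) mulr0n sub0r => c.
(* Off the diagonal the center equals [-N i j <= 0], so [2 Al i j <= Al i j + Au i j <= 0]. *)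
have := N0 i j; rewrite mxE -oppr_le0 -c pmulr_rle0 ?invr_gt0 ?ltr0n // => le0.
rewrite -(pmulrn_lle0 _ (isT : (0 < 2)%N)) mulr2n.
by apply: le_trans le0; rewrite lerD2l.
Qed.

End Interval.

Theorem proposition4 (R : realType) (n : nat) (Al Au : 'M[R]_n)
    (hle : lemx Al Au)
    (hcsym : mx_center Al Au \is symmetricmx)
    (hrsym : mx_radius Al Au \is symmetricmx)
    (hcM : M_matrix (mx_center Al Au)) :
  (strongly (@copositive R n) (interval_mx Al Au) <-> M0_matrix Al) /\
  (strongly (@strictly_copositive R n) (interval_mx Al Au) <-> M_matrix Al).
Proof.
have Al_sym := lower_symmetric hcsym hrsym.
have Al_off i j := @lower_off_diagonal _ _ _ _ hle i j hcM.
split; first by rewrite strongly_copositive_lower // copositive_M0_matrix.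
by rewrite strongly_strictly_copositive_lower // strictly_copositive_M_matrix.
Qed.
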